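(* For every integer $k\ge 2$, the infinite product $C_k$ converges and $0<C_k<1$. Furthermore, for every integer $k\ge 2$ and every positive integer $n$, $\tfrac23<f_k(n)<2$.
   Context: $p$ always denotes a prime. For positive integers $k,n$: $\psi_k(x)=\dfrac{x^k-(x-1)^k+(-1)^k}{x}$. $C_k=\prod_{p}\left(1-\dfrac{\psi_k(p)}{p^k}\right)$, the product being over all primes $p$. $f_k(n)=\prod_{p\mid n}\left(1+\dfrac{(-1)^k}{p^k-\psi_k(p)}\right)$, the product being over the primes $p$ dividing $n$ (empty product equal to $1$). *)

(* Defs.v *)
From HB Require Import structures.
From mathcomp Require Import all_boot all_order all_algebra.
From mathcomp Require Import all_classical all_reals all_analysis.

Set Implicit Arguments.
Unset Strict Implicit.
Unset Printing Implicit Defensive.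

Import Order.TTheory GRing.Theory Num.Theory.
Import numFieldNormedType.Exports.

Local Open Scope classical_set_scope.
Local Open Scope ring_scope.

Definition psi (R : realType) (k : nat) (x : R) : R :=
  (x ^+ k - (x - 1) ^+ k + (-1) ^+ k) / x.

Definition C_partial (R : realType) (k N : nat) : R :=
  \prod_(0 <= p < N | prime p) (1 - psi k p%:R / p%:R ^+ k).

(* [lim] is a total operator: this is the value of the infinite product over
   the primes, taken in increasing order, only once [cvgn (C_partial R k)] is
   known. *)
Definition C_prod (R : realType) (k : nat) : R := limn (C_partial R k).

Definition f_prod (R : realType) (k n : nat) : R :=
  \prod_(p <- primes n) (1 + (-1) ^+ k / (p%:R ^+ k - psi k p%:R)).

(* Main.v *)
(** Put [D := p^k - psi_k(p)], so that the factors of [C_k] are [D / p^k] and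
    those of [f_k] are [1 +/- 1 / D]. The factors of [C_k] lie in [(0, 1)] and
    are at least [1 - (k + 1) / p^2], so the partial products decrease and stay
    away from [0]. For fixed parity of [k] the least [D] occurs at [k = 2] or
    [k = 3]; hence [f_k] stays between [1] and the product of
    [(1 - 1 / (p^2 - 1))^-1] for even [k], and between the product of
    [1 - 1 / (p^3 - 3 p + 3)] and [1] for odd [k]. Every tail product is
    bounded by a telescoping quotient [G M / G N]. *)
Require Import Defs.
From mathcomp Require Import all_boot all_order all_algebra.
From mathcomp Require Import all_classical all_reals all_analysis.
From mathcomp Require Import ring lra zify.
Import Order.TTheory GRing.Theory Num.Theory.
Import numFieldNormedType.Exports.
Local Open Scope classical_set_scope.
Local Open Scope ring_scope.

(** * Estimates for [psi k x] at real [x >= 2] *)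

Lemma mulr_sub_psi (R : realType) (k : nat) (x : R) : x != 0 ->
  x * (x ^+ k - psi k x) = (x - 1) * x ^+ k + (x - 1) ^+ k - (-1) ^+ k.
Proof. by move=> x0; rewrite /psi mulrBr mulrCA mulfV // mulr1; ring. Qed.

Lemma psi_gt0 (R : realType) (k : nat) (x : R) : (2 <= k)%N -> 2 <= x ->
  0 < psi k x.
Proof.
move=> k2 x2; rewrite /psi divr_gt0 //; last lra.
have sgn : -1 <= (-1) ^+ k :> R.
  by rewrite -signr_odd; case: (odd k); rewrite ?expr1 ?expr0; lra.
(* Since [(-1)^k >= -1], this makes the numerator at least [x - 1]. *)
suff : (x - 1) ^+ k + x <= x ^+ k by lra.
elim: k k2 {sgn} => // -[|[|k]] // IH _; first by rewrite !expr2; nra.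
have {}IH := IH isT.
have y0 : 0 <= (x - 1) ^+ k.+2 by apply: exprn_ge0; lra.
rewrite [in X in X + _ <= _]exprS [leRHS]exprS; nra.
Qed.

(** After multiplication by [x], neither [(x - 1) x^k] nor [(x - 1)^k] decreases with [k], because
    [x - 1 >= 1], and parity fixes the sign term; the left side is the value at [k = 2]. *)
Lemma sub_psi_ge_even (R : realType) (k : nat) (x : R) :
  ~~ odd k -> (2 <= k)%N -> 2 <= x -> x ^+ 2 - 2 <= x ^+ k - psi k x.
Proof.
move=> ek k2 x2; have x0 : 0 < x by lra.
rewrite -(ler_pM2l x0) mulr_sub_psi ?gt_eqF// -signr_odd (negbTE ek) expr0.
have h1 : x ^+ 2 <= x ^+ k by apply: ler_weXn2l => //; lra.
have h2 : (x - 1) ^+ 2 <= (x - 1) ^+ k by apply: ler_weXn2l => //; lra.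
have h3 : (x - 1) * x ^+ 2 <= (x - 1) * x ^+ k by rewrite ler_wpM2l//; lra.
have -> : x * (x ^+ 2 - 2) = (x - 1) * x ^+ 2 + (x - 1) ^+ 2 - 1 by ring.
lra.
Qed.

(** The same monotonicity, now starting from [k = 3]. *)
Lemma sub_psi_ge_odd (R : realType) (k : nat) (x : R) :
  odd k -> (2 <= k)%N -> 2 <= x -> x ^+ 3 - 3 * x + 3 <= x ^+ k - psi k x.
Proof.
move=> ok k2 x2; have x0 : 0 < x by lra.
have k3 : (3 <= k)%N by case: k ok k2 => [|[|[|]]].
rewrite -(ler_pM2l x0) mulr_sub_psi ?gt_eqF// -signr_odd ok expr1.
have h1 : x ^+ 3 <= x ^+ k by apply: ler_weXn2l => //; lra.
have h2 : (x - 1) ^+ 3 <= (x - 1) ^+ k by apply: ler_weXn2l => //; lra.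
have h3 : (x - 1) * x ^+ 3 <= (x - 1) * x ^+ k by rewrite ler_wpM2l//; lra.
have -> : x * (x ^+ 3 - 3 * x + 3) =
    (x - 1) * x ^+ 3 + (x - 1) ^+ 3 + 1 by ring.
lra.
Qed.

Lemma psi_lt_expr (R : realType) (k : nat) (x : R) : (2 <= k)%N -> 2 <= x ->
  psi k x < x ^+ k.
Proof.
move=> k2 x2; rewrite -subr_gt0; case: (boolP (odd k)) => ok.
  apply: lt_le_trans (sub_psi_ge_odd _ _ _ ok k2 x2).
  by rewrite !exprS expr0; nra.
by apply: lt_le_trans (sub_psi_ge_even _ _ _ ok k2 x2); rewrite expr2; nra.
Qed.

Lemma psi_div_le (R : realType) (k : nat) (x : R) : (2 <= k)%N -> 2 <= x ->
  psi k x / x ^+ k <= k.+1%:R / x ^+ 2.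
Proof.
move=> k2 x2; have x0 : 0 < x by lra.
(* The mean value bound [x^j - (x - 1)^j <= j x^(j-1)], multiplied by [x] to avoid the exponent
   [j - 1]. The sign term will add at most one more [x^k], whence [k + 1]. *)
have expr_sub j : x * (x ^+ j - (x - 1) ^+ j) <= j%:R * x ^+ j.
  elim: j => [|j IH]; first by rewrite !expr0; lra.
  have le1 : (x - 1) ^+ j <= x ^+ j by apply: lerXn2r; rewrite ?nnegrE; lra.
  have -> : x * (x ^+ j.+1 - (x - 1) ^+ j.+1) =
    x * (x * (x ^+ j - (x - 1) ^+ j)) + x * (x - 1) ^+ j by rewrite !exprS; ring.
  have -> : j.+1%:R * x ^+ j.+1 = x * (j%:R * x ^+ j) + x * x ^+ j.
    by rewrite -natr1 exprS; ring.
  by rewrite lerD// ler_pM2l.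
have sgn : (-1) ^+ k <= 1 :> R.
  by rewrite -signr_odd; case: (odd k); rewrite ?expr1 ?expr0; lra.
have xk : x <= x ^+ k by rewrite -[leLHS]expr1; apply: ler_weXn2l; [lra|lia].
rewrite ler_pdivrMr ?exprn_gt0// mulrAC ler_pdivlMr ?exprn_gt0//.
rewrite /psi expr2 mulrA divfK ?gt_eqF//.
have := expr_sub k; rewrite -natr1; nra.
Qed.

(** * Finite products over primes *)

(** Primes below [N] outside [s] contribute factors at most 1. This lets an initial segment of the
    primes stand in for the prime divisors of [n]. *)
Lemma le_prod_primes_nat (R : realType) (a : nat -> R) (s : seq nat) (N : nat) :
  (forall p, prime p -> 0 < a p <= 1) -> uniq s -> all prime s ->
  {in s, forall p, (p < N)%N} ->
  \prod_(0 <= p < N | prime p) a p <= \prod_(p <- s) a p.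
Proof.
move=> a01 us ps sN.
have -> : \prod_(p <- s) a p = \prod_(0 <= p < N | prime p && (p \in s)) a p.
  rewrite -[RHS]big_filter; apply: perm_big; apply: uniq_perm => //.
    by rewrite filter_uniq// iota_uniq.
  move=> p; rewrite mem_filter mem_index_iota /=.
  case ins: (p \in s); rewrite ?andbF//= andbT sN// andbT.
  by rewrite (allP ps).
rewrite (bigID (mem s)) /= ler_piMr//.
  by apply: prodr_ge0 => p /andP[/a01/andP[/ltW]].
by apply: prodr_ile1 => p /andP[/a01/andP[/ltW -> ->]].
Qed.

(** Induction on [N]: at a prime the factor [a m] pays for the step from [G m] to [G m.+1]; at other
    indices the factor is 1 and monotonicity of [G] suffices. *)
Lemma prod_primes_telescope (R : realType) (a G : nat -> R) (M N : nat) :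
  (forall m, (M <= m)%N -> prime m -> 0 < a m) ->
  (forall m, (M <= m)%N -> prime m -> G m <= a m * G m.+1) ->
  (forall m, (M <= m)%N -> G m <= G m.+1) ->
  (M <= N)%N -> G M <= (\prod_(M <= p < N | prime p) a p) * G N.
Proof.
move=> a0 aG GG; elim: N => [|N IH].
  by rewrite leqn0 => /eqP ->; rewrite big_geq// mul1r.
rewrite leq_eqVlt => /predU1P[<-|MN]; first by rewrite big_geq// mul1r.
apply: le_trans (IH MN) _.
have P0 : 0 <= \prod_(M <= p < N | prime p) a p.
  rewrite big_nat_cond; apply: prodr_ge0 => p /andP[/andP[Mp _] pp].
  exact: ltW (a0 _ _ _).
rewrite [in leRHS]big_mkcond big_nat_recr//= -big_mkcond /= -mulrA ler_wpM2l//.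
by case: ifP => [pN|_]; rewrite ?mul1r; [exact: aG|exact: GG].
Qed.

(** * Factors and partial products of [C_k] *)

Lemma C_factor_bounds (R : realType) (k p : nat) : (2 <= k)%N -> prime p ->
  0 < 1 - psi k (p%:R : R) / p%:R ^+ k < 1.
Proof.
move=> k2 /prime_gt1 p1.
have p2 : 2 <= p%:R :> R by rewrite ler_nat.
have X0 : 0 < p%:R ^+ k :> R by rewrite exprn_gt0//; lra.
rewrite subr_gt0 ltr_pdivrMr// mul1r psi_lt_expr//= gtrBl.
by rewrite divr_gt0// psi_gt0.
Qed.

Lemma C_partial_gt0 (R : realType) (k N : nat) : (2 <= k)%N -> 0 < C_partial R k N.
Proof. by move=> k2; apply: prodr_gt0 => p /(C_factor_bounds R _ _ k2)/andP[]. Qed.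

Lemma C_partial_nonincreasing (R : realType) (k : nat) : (2 <= k)%N ->
  nonincreasing_seq (C_partial R k).
Proof.
move=> k2; apply/nonincreasing_seqP => N.
rewrite /C_partial [leLHS]big_mkcond big_nat_recr//= -big_mkcond /=.
apply: ler_piMr; first by rewrite ltW// C_partial_gt0.
by case: ifP => // /(C_factor_bounds R _ _ k2)/andP[_ /ltW].
Qed.

Lemma C_partial_bounded_away (R : realType) (k : nat) : (2 <= k)%N ->
  exists2 e : R, 0 < e & forall N, e <= C_partial R k N.
Proof.
(* With [c = k + 1], the choice [G m = 1 - c / (m - 1)] telescopes against factors [1 - c / m^2];
   starting at [k + 3] gives [G M = 1 / (k + 2) > 0]. *)
move=> k2; pose M := k.+3.
pose G m : R := 1 - k.+1%:R / (m%:R - 1).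
have GM : 0 < G M.
  rewrite /G /M subr_gt0 ltr_pdivrMr -?natr1 ?addrK ?natr1;
    first by rewrite mul1r -natr1; lra.
  by rewrite ltr0n.
exists (C_partial R k M * G M); first by rewrite mulr_gt0// C_partial_gt0.
have G1 m : (M <= m)%N -> G m <= 1.
  move=> Mm; rewrite /G gerBl divr_ge0//.
  by rewrite subr_ge0 ler1n (leq_trans _ Mm).
have big N : (M <= N)%N -> C_partial R k M * G M <= C_partial R k N.
  move=> MN; rewrite [leRHS](@big_cat_nat _ _ _ M)//= ler_pM2l ?C_partial_gt0//.
  have P0 : 0 < \prod_(M <= p < N | prime p) (1 - psi k p%:R / p%:R ^+ k : R).
    by apply: prodr_gt0 => p /(C_factor_bounds R _ _ k2)/andP[].
  apply: (@le_trans _ _ (\prod_(M <= p < N | prime p)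
    (1 - psi k p%:R / p%:R ^+ k : R) * G N)); last first.
    by rewrite ler_piMr ?G1// ltW.
  apply: prod_primes_telescope => // m Mm => [/(C_factor_bounds R _ _ k2)/andP[]//|pm|].
  - have cm : k.+1%:R + 2 <= m%:R :> R by rewrite -natrD ler_nat; rewrite /M in Mm; lia.
    have c0 : 0 <= k.+1%:R :> R by [].
    have := @psi_div_le R k m%:R k2 _; rewrite ler_nat prime_gt1// => /(_ isT) le_psi.
    have Gm1 : 0 <= G m.+1.
      by rewrite /G -[m.+1%:R]natr1 addrK subr_ge0 ler_pdivrMr; lra.
    apply: (@le_trans _ _ ((1 - k.+1%:R / m%:R ^+ 2) * G m.+1)); last first.
      by rewrite ler_wpM2r//; lra.
    rewrite /G -[m.+1%:R]natr1 addrK; move: c0 cm {le_psi Gm1}.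
    move: k.+1%:R m%:R => c x c0 cx.
    rewrite -subr_ge0.
    have -> : (1 - c / x ^+ 2) * (1 - c / x) - (1 - c / (x - 1)) =
      (c * (x + c * (x - 1))) / (x ^+ 3 * (x - 1)).
      by field; lra.
    apply: divr_ge0; first nra.
    by rewrite mulr_ge0 ?exprn_ge0//; lra.
  - rewrite /G lerB// ler_pM// ?invr_ge0 ?subr_ge0 ?ler1n//.
    rewrite lef_pV2 ?posrE ?subr_gt0 ?ltr1n ?lerB ?ler_nat//; rewrite /M in Mm; lia.
move=> N; case: (leqP M N) => [|/ltnW NM]; first exact: big.
apply: le_trans (C_partial_nonincreasing R _ k2 _ _ NM).
exact: big.
Qed.

(** * Extremal products for [f_k] *)

(** This factor is the reciprocal of [1 + 1 / (p^2 - 2)], the factor of [f_2], so an upper bound on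
    [f_k] becomes a lower bound on a product. *)
Lemma even_factor_bounds (R : realType) (p : nat) : prime p ->
  0 < 1 - ((p%:R : R) ^+ 2 - 1)^-1 <= 1.
Proof.
move=> /prime_gt1 p1; have p2 : 2 <= p%:R :> R by rewrite ler_nat.
have d1 : 1 < p%:R ^+ 2 - 1 :> R by rewrite expr2; nra.
by rewrite subr_gt0 invf_lt1 ?d1 ?gerBl ?invr_ge0; lra.
Qed.

Lemma odd_factor_bounds (R : realType) (p : nat) : prime p ->
  0 < 1 - ((p%:R : R) ^+ 3 - 3 * p%:R + 3)^-1 <= 1.
Proof.
move=> /prime_gt1 p1; have p2 : 2 <= p%:R :> R by rewrite ler_nat.
have d1 : 1 < p%:R ^+ 3 - 3 * p%:R + 3 :> R by rewrite !exprS expr0; nra.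
by rewrite subr_gt0 invf_lt1 ?d1 ?gerBl ?invr_ge0; lra.
Qed.

(** The primes 2 and 3 give [2/3 * 7/8 = 7/12] and the tail exceeds [G 5 = 37/43]; the result
    [259/516] is barely above [1/2]. *)
Lemma prod_even_gt (R : realType) (N : nat) :
  1 / 2 < \prod_(0 <= p < N.+4.+1 | prime p) (1 - (p%:R ^+ 2 - 1)^-1 : R).
Proof.
rewrite (@big_cat_nat _ _ _ 5)//= big_mkcond /= !big_nat_recr//= big_nil.
(* Depending on [m] through [m./2] only, [G] telescopes over odd numbers; over
   all integers the bound would be too weak. *)
pose G (m : nat) : R := (20 * (m./2)%:R - 3) / (20 * (m./2)%:R + 3).
have := @prod_primes_telescope R (fun p => 1 - (p%:R ^+ 2 - 1)^-1) G 5 N.+4.+1.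
set P := \prod_(5 <= p < N.+4.+1 | prime p) _ => H.
have half2 m : (5 <= m)%N -> 2 <= (m./2)%:R :> R by move=> m5; rewrite ler_nat; lia.
have {}H : G 5 <= P * G N.+4.+1.
  apply: H => // m m5.
  - by move=> /(even_factor_bounds R)/andP[].
  (* For [m = 2 t + 1] the half passes from [t] to [t + 1]. The numerator below equals
     [80 t^2 + 80 t - 51], positive for [t >= 2]. *)
  - move=> pm; have om : odd m by case: (even_prime pm) => // m2; rewrite m2 in m5.
    have := half2 _ m5; rewrite /G.
    have -> : m.+1./2 = (m./2).+1 by lia.
    have -> : m%:R = 2 * (m./2)%:R + 1 :> R.
      by rewrite -natrM natr1; congr _%:R; lia.
    rewrite -[(m./2).+1%:R]natr1; move: (m./2)%:R => t t2.
    rewrite -subr_ge0.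
    have -> : (1 - ((2 * t + 1) ^+ 2 - 1)^-1) * ((20 * (t + 1) - 3) / (20 * (t + 1) + 3))
        - (20 * t - 3) / (20 * t + 3) =
      (120 * (4 * t ^+ 2 + 4 * t) - (20 * t + 17) * (20 * t + 3)) /
      (((2 * t + 1) ^+ 2 - 1) * (20 * (t + 1) + 3) * (20 * t + 3)).
      by field; rewrite ?expr2; do ?split; nra.
    apply: divr_ge0; rewrite ?expr2; first nra.
    by apply: mulr_ge0; [apply: mulr_ge0|]; nra.
  - have := half2 _ m5; rewrite /G => h2.
    have : (m./2)%:R <= (m.+1./2)%:R :> R by rewrite ler_nat; lia.
    move: (m./2)%:R (m.+1./2)%:R h2 => t u h2 tu.
    rewrite ler_pdivrMr; last lra.
    by rewrite mulrAC ler_pdivlMr; nra.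
have GN : G N.+4.+1 < 1.
  by have := half2 N.+4.+1 isT; rewrite /G => h; rewrite ltr_pdivrMr; lra.
have P0 : 0 < P by apply: prodr_gt0 => p /(even_factor_bounds R)/andP[].
have PG : P * G N.+4.+1 < P by rewrite gtr_pMr.
rewrite !mul1r /= !expr2 {GN P0}.
have G5 : G 5 = 37 / 43 by rewrite /G -[5./2]/2%N; congr (_ / _); lra.
rewrite G5 in H.
rewrite (_ : 2 * 2 - 1 = 3 :> R); last lra.
rewrite (_ : 3 * 3 - 1 = 8 :> R); last lra.
lra.
Qed.

(** The prime 2 gives [4/5] and the tail exceeds [G 3 = 17/20]; their product is [17/25 > 2/3]. *)
Lemma prod_odd_gt (R : realType) (N : nat) :
  2 / 3 < \prod_(0 <= p < N.+3 | prime p) (1 - (p%:R ^+ 3 - 3 * p%:R + 3)^-1 : R).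
Proof.
rewrite (@big_cat_nat _ _ _ 3)//= big_mkcond /= !big_nat_recr//= big_nil.
(* For a constant [c] in place of [3/10], telescoping at 3 needs [c >= 6/23] and the final
   comparison needs [c < 1/3]. *)
pose G m : R := 1 - (3 / 10) / (m%:R - 1).
have := @prod_primes_telescope R
  (fun p => 1 - (p%:R ^+ 3 - 3 * p%:R + 3)^-1) G 3 N.+3.
set P := \prod_(3 <= p < N.+3 | prime p) _ => H.
have le3 m : (3 <= m)%N -> 3 <= m%:R :> R by rewrite ler_nat.
have {}H : G 3 <= P * G N.+3.
  apply: H => // m /le3 m3.
  - by move=> /(odd_factor_bounds R)/andP[].
  - move=> _; rewrite /G -[m.+1%:R]natr1 addrK; move: m%:R m3 => x x3.
    have : (x - 3 / 10) * (x - 1) <= 3 / 10 * (x ^+ 3 - 3 * x + 3).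
      have : 0 <= (x - 3) ^+ 2 * (x - 3) by rewrite mulr_ge0 ?sqr_ge0//; lra.
      by rewrite !exprS expr0; nra.
    have : 0 < x ^+ 3 - 3 * x + 3 by rewrite !exprS expr0; nra.
    move: (x ^+ 3 - 3 * x + 3) => d d0 le_d; rewrite -subr_ge0.
    have -> : (1 - d^-1) * (1 - 3 / 10 / x) - (1 - 3 / 10 / (x - 1)) =
      (3 / 10 * d - (x - 3 / 10) * (x - 1)) / (d * x * (x - 1)).
      by field; do ?split; lra.
    by rewrite divr_ge0 ?subr_ge0// !mulr_ge0//; lra.
  - rewrite /G -[m.+1%:R]natr1 addrK lerB// ler_pM2l// lef_pV2 ?posrE; lra.
have GN : G N.+3 < 1.
  by have := le3 N.+3 isT; rewrite /G => h; rewrite gtrBl divr_gt0//; lra.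
have P0 : 0 < P by apply: prodr_gt0 => p /(odd_factor_bounds R)/andP[].
have PG : P * G N.+3 < P by rewrite gtr_pMr.
rewrite !mul1r /= !exprS !expr0 {GN P0}.
have G3 : G 3 = 17 / 20 by rewrite /G (_ : 3 - 1 = 2 :> R); lra.
rewrite G3 in H.
rewrite (_ : 2 * (2 * (2 * 1)) - 3 * 2 + 3 = 5 :> R); last lra.
lra.
Qed.

(** * Bounds for [C_k] and [f_k] *)

Lemma C_prod_cvg_bounds (R : realType) (k : nat) : (2 <= k)%N ->
  cvgn (C_partial R k) /\ 0 < C_prod R k < 1.
Proof.
move=> k2; have noninc := C_partial_nonincreasing R _ k2.
have [e e0 Ce] := C_partial_bounded_away R _ k2.
have Ccvg : cvgn (C_partial R k).
  by apply: nonincreasing_is_cvgn => //; exists e => _ [N _ <-].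
split=> //; apply/andP; split.
  by apply: (lt_le_trans e0); apply: limr_ge => //; apply: nearW.
(* The partial product at 3 consists of the factor at 2 alone, already strictly below 1. *)
apply: (le_lt_trans (nonincreasing_cvgn_ge noninc Ccvg 3)).
rewrite /C_partial big_mkcond /= !big_nat_recr//= big_nil !mul1r.
by have /andP[] := C_factor_bounds R _ _ k2 (isT : prime 2).
Qed.

Lemma f_prod_bounds (R : realType) (k n : nat) : (2 <= k)%N ->
  2 / 3 < f_prod R k n < 2.
Proof.
move=> k2; have ps : all prime (primes n).
  by apply/allP => p; rewrite mem_primes => /andP[].
have [N ltN] : exists N, {in primes n, forall p, (p < N)%N}.
  exists (\max_(p <- primes n) p).+1 => p ip.
  by rewrite ltnS (big_rem _ ip) /= leq_maxl.
(* The shifts keep the ranges beyond the split points 5 and 3. *)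
have ltN5 : {in primes n, forall p, (p < N.+4.+1)%N} by move=> p /ltN; lia.
have ltN3 : {in primes n, forall p, (p < N.+3)%N} by move=> p /ltN; lia.
have p2 p : p \in primes n -> 2 <= p%:R :> R.
  by move=> /(allP ps) /prime_gt1; rewrite ler_nat.
rewrite /f_prod -signr_odd; case: (boolP (odd k)) => ok; rewrite ?expr1 ?expr0.
- have D x : 2 <= x -> 1 < x ^+ k - psi k x :> R.
    move=> x2; apply: lt_le_trans (sub_psi_ge_odd _ _ _ ok k2 x2).
    by rewrite !exprS expr0; nra.
  apply/andP; split.
    apply: (lt_le_trans (prod_odd_gt R N)).
    apply: le_trans (le_prod_primes_nat R _ _ _ (odd_factor_bounds R)
      (primes_uniq n) ps ltN3) _.
    rewrite big_seq [leRHS]big_seq; apply: ler_prod => p ip.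
    have /andP[/ltW -> _] /= := odd_factor_bounds R _ (allP ps _ ip).
    rewrite mulN1r lerB// lef_pV2 ?posrE; first exact: sub_psi_ge_odd (p2 _ ip).
      by apply: lt_trans (D _ (p2 _ ip)).
    by have := p2 _ ip; rewrite !exprS expr0; nra.
  apply: (@le_lt_trans _ _ 1); last lra.
  rewrite big_seq; apply: prodr_ile1 => p ip.
  have := D _ (p2 _ ip) => d1.
  by rewrite mulN1r subr_ge0 invf_le1 ?gerBl ?invr_ge0; lra.
- have D x : 2 <= x -> 1 < x ^+ k - psi k x :> R.
    move=> x2; apply: lt_le_trans (sub_psi_ge_even _ _ _ ok k2 x2).
    by rewrite expr2; nra.
  set f := \prod_(p <- primes n) _.
  have f1 : 1 <= f.
    rewrite /f big_seq; apply: (big_ind (fun y => 1 <= y)) => // [y z|p ip];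
      first exact: mulr_ege1.
    by rewrite lerDl divr_ge0//; have := D _ (p2 _ ip); lra.
  have := lt_le_trans (prod_even_gt R N)
    (le_prod_primes_nat R _ _ _ (even_factor_bounds R) (primes_uniq n) ps ltN5).
  set h := \prod_(p <- primes n) _ => h2.
  (* As [h > 1/2], this forces [f < 2]. Factorwise, with [e = p^2 - 2 <= d], it reads
     [(d + 1) e <= d (e + 1)]. *)
  suff fh : f * h <= 1 by apply/andP; split; nra.
  rewrite /f /h -big_split big_seq; apply: prodr_ile1 => p ip /=.
  have x2 := p2 _ ip; have d1 := D _ x2.
  have := sub_psi_ge_even _ _ _ ok k2 x2.
  move: (p%:R ^+ k - psi k p%:R) d1 => d d1.
  have : 2 <= p%:R ^+ 2 - 2 :> R by rewrite expr2; nra.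
  have -> : p%:R ^+ 2 - 1 = (p%:R ^+ 2 - 2) + 1 :> R by ring.
  move: (p%:R ^+ 2 - 2) => e e2 ed.
  have -> : (1 + 1 / d) * (1 - (e + 1)^-1) = ((d + 1) * e) / (d * (e + 1)).
    by field; do ?split; lra.
  rewrite divr_ge0 ?mulr_ge0 ?ler_pdivrMr ?mulr_gt0//=; nra.
Qed.

Theorem theorem3 (R : realType) :
  (forall k : nat, (2 <= k)%N ->
     cvgn (C_partial R k) /\ 0 < C_prod R k < 1) /\
  (forall k n : nat, (2 <= k)%N -> (0 < n)%N ->
     2 / 3 < f_prod R k n < 2).
Proof.
split=> [k k2|k n k2 _]; first exact: C_prod_cvg_bounds.
exact: f_prod_bounds.
Qed.
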